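(* The order on $\mathbb{N}$ induced by the usual order on the rationals cannot arise from any $S\in\mathcal{S}_\infty$. That is, for every bijection $\phi:\mathbb{Q}\to\mathbb{N}$, letting $\prec_\phi$ be the order on $\mathbb{N}$ given by $x\prec_\phi y\Leftrightarrow\phi^{-1}(x)<\phi^{-1}(y)$, there is no $S\in\mathcal{S}_\infty$ with $\prec_S=\prec_\phi$.
   Context: $\mathbb{N}=\{0,1,2,\dots\}$. For $m\in\mathbb{N}$ let $[m]=\{0,\dots,m-1\}$; also $[+\infty]=\mathbb{N}$ and $[-\infty]=-\mathbb{N}=\{\dots,-2,-1,0\}$. Uniform sets. For $t\in\mathbb{N}$ and $\varepsilon\in\{+,-\}$, $\mathcal{U}_{2t}^{\varepsilon}$ is the set of families $(s(i_0,\dots,i_t))$ of natural numbers indexed by $[m_0]\times[m_1]\times\cdots\times[m_t]$, where $m_0\in\mathbb{N}$ is arbitrary (finite) and $m_1=\cdots=m_t=\varepsilon\infty$; $\mathcal{U}_{2t+1}^{\varepsilon}$ is the set of such families with $m_0=\cdots=m_t=\varepsilon\infty$. Set $\mathcal{U}_d=\mathcal{U}_d^+\cup\mathcal{U}_d^-$ and $\mathcal{U}=\bigcup_{d\ge0}\mathcal{U}_d$. Mixed sets. $\mathcal{U}_\infty$ is the set of nonempty finite or infinite sequences $S=(S_t)_{t\in[m]}$, $m\in\{1,2,\dots\}\cup\{+\infty\}$, with $S_t\in\mathcal{U}$. Write $S_t=\big(s(t)(I)\big)_{I\in\Pi_{t,k_t}}$ with $\Pi_{t,k_t}=[m_{t,1}]\times\cdots\times[m_{t,k_t}]$,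 where $k_t$ is the number of indices of $S_t$. Let $\langle S\rangle\subseteq\mathbb{N}$ be the set of all values $s(t)(I)$. $S$ is injective if $s(t)(I)\ne s(p)(J)$ whenever $(t,I)\neq(p,J)$. Let $\mathcal{S}_\infty=\{S\in\mathcal{U}_\infty:\langle S\rangle=\mathbb{N},\ S\text{ injective}\}$. For $S\in\mathcal{S}_\infty$ and $x=s(t)(i_{t,1},\dots,i_{t,k_t})$, the address is $\mathsf{ad}_S(x)=(t,i_{t,1},\dots,i_{t,k_t})$. The order $\prec_S$ on $\mathbb{N}$ is defined by $x\prec_S y$ iff $\mathsf{ad}_S(x)\vartriangleleft\mathsf{ad}_S(y)$, where $\vartriangleleft$ is the lexicographic order on $\bigcup_{k\ge1}\mathbb{Z}^k$ (entries compared by the usual order of $\mathbb{Z}$, a proper prefix being smaller). *)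

(* Defs.v *)
From mathcomp Require Import all_boot all_order all_algebra.
Set Implicit Arguments.
Unset Strict Implicit.
Unset Printing Implicit Defensive.
Import Order.TTheory GRing.Theory Num.Theory.
Local Open Scope ring_scope.

Inductive sign := Plus | Minus.

Inductive extent := Fin of nat | PInf | MInf.

Definition inf_extent (eps : sign) : extent :=
  match eps with Plus => PInf | Minus => MInf end.

(* [m], [+oo] and [-oo], as subsets of Z; note that 0 belongs to [-oo]. *)
Definition ivl (m : extent) : {pred int} :=
  fun i => match m with
           | Fin n => (0 <= i) && (i < n%:Z)
           | PInf => 0 <= i
           | MInf => i <= 0
           end.

(* The product of the ivl m for m in ms; all2 forces I and ms to have the
   same length. *)
Definition box (ms : seq extent) : {pred seq int} :=
  fun I => all2 (fun m i => i \in ivl m) ms I.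

Record nat_family := NatFamily {
  dims : seq extent;
  entry : {I : seq int | I \in box dims} -> nat
}.

Definition uniform_dims (eps : sign) (d : nat) (ms : seq extent) : Prop :=
  if odd d then ms = nseq d./2.+1 (inf_extent eps)
  else exists m0 : nat, ms = Fin m0 :: nseq d./2 (inf_extent eps).

Definition uniform_signed (eps : sign) (d : nat) (F : nat_family) : Prop :=
  uniform_dims eps d (dims F).

Definition uniform_at (d : nat) (F : nat_family) : Prop :=
  uniform_signed Plus d F \/ uniform_signed Minus d F.

Definition uniform (F : nat_family) : Prop := exists d : nat, uniform_at d F.

(* The set U_oo; the position t of a component is an integer so that it can
   be the first entry of an address. *)
Record mixed := Mixed {
  len : extent;
  len_pos : len = PInf \/ exists m : nat, len = Fin m.+1;
  comp : {t : int | t \in ivl len} -> nat_family;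
  comp_uniform : forall t, uniform (comp t)
}.

(* The pairs (t, I) with t a position in S and I an index of S_t. *)
Definition mixed_index (S : mixed) : Type :=
  {t : {t : int | t \in ivl (len S)} & {I : seq int | I \in box (dims (comp t))}}.

Definition value (S : mixed) (p : mixed_index S) : nat := entry (tagged p).

Definition address (S : mixed) (p : mixed_index S) : seq int :=
  val (tag p) :: val (tagged p).

(* The set S_oo: injective mixed sets S with <S> = N. *)
Record S_inf := SInf {
  mixed_of :> mixed;
  value_inj : injective (@value mixed_of);
  value_surj : forall x : nat, exists p : mixed_index mixed_of, value p == x
}.

Definition ad (S : S_inf) (x : nat) : seq int :=
  address (xchoose (value_surj S x)).

Lemma ad_value (S : S_inf) (p : mixed_index S) : ad S (value p) = address p.
Proof.
by congr address; exact/(@value_inj S)/eqP/(xchooseP (value_surj S _)).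
Qed.

(* seqlexi is the lexicographic order on finite sequences, in which a proper
   prefix is smaller. *)
Definition prec (S : S_inf) : rel nat :=
  fun x y => ((ad S x : seqlexi int) < (ad S y : seqlexi int))%O.

Definition prec_rat (phi_inv : nat -> rat) : rel nat :=
  fun x y => phi_inv x < phi_inv y.

(* Main.v *)
Require Import Defs.
From mathcomp Require Import all_boot all_order all_algebra.
Set Implicit Arguments.
Unset Strict Implicit.
Unset Printing Implicit Defensive.
Import Order.TTheory GRing.Theory Num.Theory.
Local Open Scope ring_scope.

(** Write the induced order on addresses.  The order of the rationals is dense
    and has no least element, and these two properties pass to the set of
    addresses of [S], since every address is that of a natural number.

    If a nonempty component has an infinite last dimension, then two of its
    addresses agree up to a last entry that is [a] for one and [a + 1] for the
    other.  No address lies between them ([lexi_succ_gap]): it would belong to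
    the same component, hence have the same length.  This contradicts
    density, so every nonempty component is a finite sequence with one index
    ([component_Fin]).

    But then the address [t; 0] precedes all other addresses of component [t],
    so that an address below it comes from an earlier nonempty component.
    Repeating this gives an infinite descent in the positions, which are
    nonnegative. *)

Lemma lexi_squeeze (a b : int) (I J K : seq int) :
    ((a :: I : seqlexi int) < (b :: J : seqlexi int))%O ->
    ((b :: J : seqlexi int) < (a :: K : seqlexi int))%O ->
  [/\ b = a, ((I : seqlexi int) < (J : seqlexi int))%O
    & ((J : seqlexi int) < (K : seqlexi int))%O].
Proof.
rewrite !ltxi_cons => /andP[le_ab IJ] /andP[le_ba JK].
by rewrite le_ba le_ab in IJ JK; split=> //; apply/le_anti/andP.
Qed.

(** A sequence in between would have to start with [u], and its one remaining
    entry would lie strictly between [a] and [a + 1].  Without the condition on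
    the length, the proper extensions of [rcons u a] would lie there. *)
Lemma lexi_succ_gap (u w : seq int) (a : int) :
    size w = (size u).+1 ->
    ((rcons u a : seqlexi int) < (w : seqlexi int))%O ->
  ~~ ((w : seqlexi int) < (rcons u (a + 1) : seqlexi int))%O.
Proof.
elim: u w => [|b u IHu] [|c w] //= [size_w] lt_uw; last first.
  by apply/negP=> /(lexi_squeeze lt_uw)[_ /(IHu _ size_w)/negP].
case: w size_w lt_uw => // _; rewrite !ltxi_cons ltxx !implybF -!ltNge.
by case/andP=> _ lt_ac; rewrite ltzD1 [c <= a]leNgt lt_ac andbF.
Qed.

Lemma size_box (ms : seq extent) (I : seq int) : I \in box ms -> size I = size ms.
Proof. by rewrite /in_mem /= /box all2E => /andP[/eqP]. Qed.

Lemma box_rcons (ms : seq extent) (m : extent) (u : seq int) (a : int) :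
  (rcons u a \in box (rcons ms m)) = (u \in box ms) && (a \in ivl m).
Proof.
rewrite /in_mem /= /box !all2E !size_rcons eqSS.
case: eqP => //= eq_sz; rewrite zip_rcons // all_rcons andbC.
by rewrite /in_mem.
Qed.

Lemma inf_extent_succ (eps : sign) :
  exists2 a, a \in ivl (inf_extent eps) & a + 1 \in ivl (inf_extent eps).
Proof. by case: eps; [exists 0 | exists (-1)]. Qed.

(** All that the argument retains of uniformity: only the first dimension can
    be finite, so the last one is finite only if it is the first. *)
Lemma uniform_last (F : nat_family) : uniform F ->
  (exists m, dims F = [:: Fin m]) \/
  (exists ms eps, dims F = rcons ms (inf_extent eps)).
Proof.
have rcons_nseq n (e : extent) : nseq n.+1 e = rcons (nseq n e) e.
  by elim: n => //= n ->.
have dimsP eps d ms : uniform_dims eps d ms -> (exists m, ms = [:: Fin m]) \/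
    (exists ms' eps', ms = rcons ms' (inf_extent eps')).
  rewrite /uniform_dims; case: odd => [->|[m ->]].
    by right; exists (nseq d./2 (inf_extent eps)), eps; rewrite rcons_nseq.
  case: d./2 => [|n]; first by left; exists m.
  right; exists (Fin m :: nseq n (inf_extent eps)), eps.
  by rewrite rcons_nseq.
by case=> d [|] /dimsP.
Qed.

Lemma position_ge0 (S : mixed) (t : int) : t \in ivl (len S) -> 0 <= t.
Proof. by case: (len_pos S) => [->|[m ->]] // /andP[]. Qed.

Section Addresses.

Variable S : mixed.

Definition address_lt (p q : mixed_index S) : bool :=
  ((address p : seqlexi int) < (address q : seqlexi int))%O.

Definition mkindex (t : {t : int | t \in ivl (len S)}) (I : seq int)
    (It : I \in box (dims (Defs.comp t))) : mixed_index S :=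
  existT _ t (exist _ I It).

Definition address_dense : Prop := forall p q, address_lt p q ->
  exists2 r, address_lt p r & address_lt r q.

Definition address_unbounded : Prop := forall p, exists q, address_lt q p.

(** The index [p] only serves to make its component nonempty: if the last
    dimension is infinite, replacing the last entry of an index by two
    consecutive integers gives two adjacent addresses. *)
Lemma component_Fin (p : mixed_index S) : address_dense ->
  exists m, dims (Defs.comp (tag p)) = [:: Fin m].
Proof.
move=> dense; case: p => t [I It] /=.
have [//|[ms [eps dims_t]]] := uniform_last (comp_uniform t).
have [u box_u]: exists u, u \in box ms.
  case/lastP: I It => [|u a]; rewrite dims_t.
    by move/size_box; rewrite size_rcons.
  by rewrite box_rcons => /andP[u_ms _]; exists u.
have [a a_in a1_in] := inf_extent_succ eps.
have Ia: rcons u a \in box (dims (Defs.comp t)) by rewrite dims_t box_rcons box_u.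
have Ia1: rcons u (a + 1) \in box (dims (Defs.comp t)).
  by rewrite dims_t box_rcons box_u.
have lt_p: address_lt (mkindex Ia) (mkindex Ia1).
  rewrite /address_lt /address /= ltxi_cons lexx /=.
  elim: (u) => [|b v IHv] /=; last by rewrite ltxi_cons lexx.
  by rewrite ltxi_cons ltxx implybF -ltNge lerDl ler01 ltrDl.
have [[t' [J Jt']]] := dense _ _ lt_p.
rewrite /address_lt /address /= => lt1 /(lexi_squeeze lt1)[/val_inj eq_t].
(* Being squeezed, the third address lies in the same component. *)
have size_J: size J = (size u).+1.
  by rewrite (size_box Jt') eq_t dims_t size_rcons (size_box box_u).
by move=> /(lexi_succ_gap size_J)/negP.
Qed.

(** Induction on the position of [p]: in a component with a single, finite
    dimension, the index [0] exists and comes first, so whatever precedes it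
    lies at a smaller position. *)
Lemma address_not_dense_unbounded (p : mixed_index S) :
  address_dense -> ~ address_unbounded.
Proof.
move=> dense unbounded.
have [n] := ubnP `|val (tag p)|%N; elim: n p => // n IHn p lt_pn.
have [m dims_p] := component_Fin p dense.
case: p lt_pn dims_p => t [I It] /= lt_tn dims_t.
have I0: [:: 0] \in box (dims (Defs.comp t)).
  move: It; rewrite dims_t; case: I => [|i [|? ?]] //.
    rewrite /in_mem /= /box /= andbT => /andP[i_ge0 i_lt].
    by rewrite /in_mem /= andbT; apply: le_lt_trans i_ge0 i_lt.
  by rewrite /in_mem /= /box /= andbF.
have [[t' [J Jt']]] := unbounded (mkindex I0).
rewrite /address_lt /address /= ltxi_cons => /andP[le_t't lt_J].
have t_ge0 := position_ge0 (valP t); have t'_ge0 := position_ge0 (valP t').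
case: (ltrP (val t') (val t)) => [lt_t't | le_tt'].
  apply: (IHn (mkindex Jt')) => /=.
  by rewrite (leq_trans _ (lt_tn : _ <= n)%N) // -ltz_nat !gez0_abs.
have eq_t: t' = t by apply/val_inj/le_anti/andP.
rewrite le_tt' /= in lt_J; move: Jt' lt_J; rewrite eq_t dims_t.
case: J => [|j [|? ?]] //.
  rewrite /in_mem /= /box /= andbT => /andP[j_ge0 _].
  by rewrite ltxi_cons j_ge0 andbF.
by rewrite /in_mem /= /box /= andbF.
Qed.

End Addresses.

Theorem proposition3p23 (phi : rat -> nat) (phi_inv : nat -> rat)
    (phiK : cancel phi phi_inv) (phi_invK : cancel phi_inv phi) :
  ~ exists S : S_inf, prec S =2 prec_rat phi_inv.
Proof.
case=> S precE.
have ltE (p q : mixed_index S) :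
    address_lt p q = (phi_inv (value p) < phi_inv (value q)).
  by rewrite -[RHS]precE /prec !ad_value.
have index_rat z : exists p : mixed_index S, phi_inv (value p) = z.
  by have [p /eqP val_p] := value_surj S (phi z); exists p; rewrite val_p phiK.
have [p0 _] := index_rat 0.
apply: (address_not_dense_unbounded p0) => [p q | p]; last first.
  have [r val_r] := index_rat (phi_inv (value p) - 1).
  by exists r; rewrite ltE val_r gtrBl.
rewrite ltE => /midf_lt[lt_pz lt_zq].
have [r val_r] := index_rat ((phi_inv (value p) + phi_inv (value q)) / 2%:R).
by exists r; rewrite ltE val_r.
Qed.
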